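(* Let $0<s<1$. If $H\in C(\overline{S_1\times S_1^+})$ is a $C_s$-viscosity solution to $$\begin{cases}\Delta_xH+z^{2-\frac1s}\partial_{zz}H=0&\text{in }S_1\times S_1^+\\ \partial_zH(x,0)=0&\text{on }T_1,\end{cases}$$ then $H$ attains its maximum and minimum on $\partial(S_1\times S_1^+)\cap\{z>0\}$.
   Context: Points of $\mathbb{R}^{n+1}$ ($n\ge1$) are written $(x,z)$, $x\in\mathbb{R}^n$, $z\in\mathbb{R}$. $h(z)=\frac{s^2}{1-s}|z|^{1/s}$. In the product $S_1\times S_1^+$, the first factor is $S_1=\{x\in\mathbb{R}^n:\frac12|x|^2<1\}$ and the second is $S_1^+=\{z>0:h(z)<1\}$; $T_1=S_1\times\{z=0\}$. $C_s$-viscosity solutions. Let $D=S_1\times S_1^+$. The class $C_s$ consists of $\phi\in C^2(D)$ such that $\phi$, its $x$-derivatives up to order two, $\partial_z\phi$, and $z^{2-\frac1s}\partial_{zz}\phi$ are continuous up to $\overline D$. A continuous $\phi$ touches $H$ from above (below) at $p$ if there is a (relatively) open convex set $E\ni p$, with $E\subset D$ if $p\in D$ and $E\subset D\cup T_1$ if $p\in T_1$, such that $\phi(p)=H(p)$ and $\phi\ge H$ ($\phi\le H$) in $E$. $H\in C(\overline D)$ is a $C_s$-viscosity subsolution (supersolution) of the problem if: (i) whenever $\phi\in C^2(D)$ touches $H$ from above (below) at $(x_0,z_0)\in D$, then $\Delta_x\phi(x_0,z_0)+z_0^{2-\frac1s}\partial_{zz}\phi(x_0,z_0)\ge0$ ($\le0$);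 (ii) whenever $\phi\in C_s$ touches $H$ from above (below) at $(x_0,0)\in T_1$, then $\partial_z\phi(x_0,0)\ge0$ ($\le0$). A $C_s$-viscosity solution is both a $C_s$-viscosity subsolution and a $C_s$-viscosity supersolution.
   Formalization: The extrema (over the closed domain) are shown attained on the closure of ∂(S_1×S_1^+)∩{z>0}, i.e. including the edge |x|²/2=1, z=0; without the edge the claim fails: for n=1, s=1/2, H=x²−z² has its maximum only at (±√2,0). *)

(* Defs.v *)
From mathcomp Require Import all_boot all_order all_algebra.
From mathcomp Require Import all_classical all_reals all_analysis.

Set Implicit Arguments.
Unset Strict Implicit.
Unset Printing Implicit Defensive.

Import Order.TTheory GRing.Theory Num.Theory.
Import numFieldNormedType.Exports.

Local Open Scope classical_set_scope.
Local Open Scope ring_scope.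

(* A point (x, z) of R^(n+1) is a pair of type 'rV[R]_n * R. The library norms
   on 'rV[R]_n and on products are sup norms: they are used for the topology
   and for difference quotients only, and |x|^2 is written out in S1. *)

Section Domain.
Variables (R : realType) (n : nat) (s : R).

Definition h (z : R) : R := s ^+ 2 / (1 - s) * `|z| `^ s^-1.

Definition S1 : set 'rV[R]_n := [set x | 2^-1 * (\sum_i x 0 i ^+ 2) < 1].

Definition S1p : set R := [set z | 0 < z /\ h z < 1].

Definition D : set ('rV[R]_n * R) := S1 `*` S1p.

Definition T1 : set ('rV[R]_n * R) := S1 `*` [set 0].

(* The part of the boundary of D that is not T1. Without the outer closure the
   points with 1/2 |x|^2 = 1 and z = 0 would be lost, and extrema may be
   attained only there: for n = 1 and s = 1/2, the solution x^2 - z^2 has its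
   maximum over closure D exactly at (sqrt 2, 0) and (- sqrt 2, 0). *)
Definition upper_boundary : set ('rV[R]_n * R) :=
  closure ((closure D `\` interior D) `&` [set p | 0 < p.2]).

End Domain.

Arguments D {R} n s.
Arguments T1 {R} n.
Arguments upper_boundary {R} n s.

Section Derivatives.
Variables (R : realType) (n : nat).
Let pt : Type := ('rV[R]_n * R)%type.

(* [Some i] is the direction x_i and [None] is the direction z. *)
Definition dir (k : option 'I_n) : 'rV[R]_n * R :=
  if k is Some i then (delta_mx 0 i, 0) else (0, 1).

Definition pd (k : option 'I_n) (phi : pt -> R) : pt -> R :=
  fun p => 'D_(dir k) phi p.

Definition C2 (A : set pt) (phi : pt -> R) : Prop :=
  [/\ {in A, continuous phi},
      forall k, {in A, forall p, derivable phi p (dir k)} /\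
                {in A, continuous (pd k phi)}
    & forall k l, {in A, forall p, derivable (pd l phi) p (dir k)} /\
                  {in A, continuous (pd k (pd l phi))}].

Definition lap_x (phi : pt -> R) (p : pt) : R :=
  \sum_(i < n) pd (Some i) (pd (Some i) phi) p.

(* The operators above need an open neighborhood, so on the boundary of A only
   the continuous extension of f from A is meaningful. *)
Definition continuous_up_to_closure (A : set pt) (f : pt -> R) : Prop :=
  exists2 g : pt -> R, {within closure A, continuous g} & {in A, f =1 g}.

Definition extension (A : set pt) (f : pt -> R) (p : pt) : R :=
  lim (f @ within A (nbhs p)).

End Derivatives.

Section Viscosity.
Variables (R : realType) (n : nat) (s : R).
Let pt : Type := ('rV[R]_n * R)%type.
Implicit Types (phi H : pt -> R) (A : set pt).

Definition weighted_dzz phi (p : pt) : R :=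
  p.2 `^ (2 - s^-1) * pd None (pd None phi) p.

(* The values of phi on the boundary of D are used in touching at T1, hence phi
   itself, and not merely its extension, is continuous on closure D. *)
Definition Cs phi : Prop :=
  [/\ C2 (D n s) phi,
      {within closure (D n s), continuous phi},
      forall i, continuous_up_to_closure (D n s) (pd (Some i) phi),
      forall i j,
        continuous_up_to_closure (D n s) (pd (Some i) (pd (Some j) phi))
    & continuous_up_to_closure (D n s) (pd None phi) /\
      continuous_up_to_closure (D n s) (weighted_dzz phi)].

Definition dz_T1 phi (x : 'rV[R]_n) : R :=
  extension (D n s) (pd None phi) (x, 0).

Definition touching_set A (p : pt) (E : set pt) : Prop :=
  [/\ E p, E `<=` A, open (E : set (subspace A)) & convex_set E].

Definition touches_above A phi H (p : pt) : Prop :=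
  exists2 E, touching_set A p E &
    phi p = H p /\ forall q, E q -> H q <= phi q.

Definition touches_below A phi H (p : pt) : Prop :=
  exists2 E, touching_set A p E &
    phi p = H p /\ forall q, E q -> phi q <= H q.

Definition Cs_subsolution H : Prop :=
  [/\ {within closure (D n s), continuous H},
      forall phi p, D n s p -> C2 (D n s) phi ->
        touches_above (D n s) phi H p ->
        0 <= lap_x phi p + weighted_dzz phi p
    & forall phi x, T1 n (x, 0) -> Cs phi ->
        touches_above (D n s `|` T1 n) phi H (x, 0) ->
        0 <= dz_T1 phi x].

Definition Cs_supersolution H : Prop :=
  [/\ {within closure (D n s), continuous H},
      forall phi p, D n s p -> C2 (D n s) phi ->
        touches_below (D n s) phi H p ->
        lap_x phi p + weighted_dzz phi p <= 0
    & forall phi x, T1 n (x, 0) -> Cs phi ->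
        touches_below (D n s `|` T1 n) phi H (x, 0) ->
        dz_T1 phi x <= 0].

Definition Cs_solution H : Prop := Cs_subsolution H /\ Cs_supersolution H.

End Viscosity.

(* Main.v *)
Require Import Defs.
From mathcomp Require Import all_boot all_order all_algebra.
From mathcomp Require Import all_classical all_reals all_analysis.
From mathcomp Require Import ring lra.
Import Order.TTheory GRing.Theory Num.Theory.
Import numFieldNormedType.Exports.
Local Open Scope classical_set_scope.
Local Open Scope ring_scope.

(** Let [P (x, z) = |x|^2 / 2 + z]. For [e > 0] the function [a - e * P] belongs
    to C_s, satisfies the strict inequality [Delta_x phi + z^(2 - 1/s) phi_zz =
    - e * n < 0] in D and has [d_z phi = - e < 0] on T1, so it touches no
    subsolution from above at a point of D or T1. Hence [H + e * P] attains its
    maximum over the closure of D on the upper boundary, and letting [e] tend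
    to 0 gives the same for [H]. The minimum is the maximum of [- H]. *)

(** Along the line through [p] the difference quotient is exactly [l + t * m], so each derivative
    below reduces to a polynomial identity in [t]. *)
Lemma is_derive_quadratic (R : realType) (V : normedModType R) (f : V -> R)
    (p v : V) (l m : R) :
  (forall t, f (t *: v + p) = f p + t * l + t ^+ 2 * m) -> is_derive p v f l.
Proof.
move=> fE.
have cvg_l : t^-1 *: ((f \o shift p) (t *: v) - f p) @[t --> 0^'] --> l.
  have lm : l + t * m @[t --> (0 : R)^'] --> l.
    rewrite -[X in _ --> X]addr0 -[X in _ --> _ + X](mul0r m).
    apply: cvgD; first exact: cvg_cst.
    by apply: cvgM; [exact: cvg_within | exact: cvg_cst].
  apply: cvg_trans lm; apply: near_eq_cvg; near=> t.
  have t0 : t != 0 by near: t; exact: nbhs_dnbhs_neq.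
  by rewrite /= fE /GRing.scale /=; field.
apply: DeriveDef; first by apply/cvg_ex; exists l.
exact: cvg_lim cvg_l.
Unshelve. all: by end_near.
Qed.

(** With both parameters free, the family is closed under negation: [b = - e] gives test functions
    from above, [b = e] those from below. *)
Definition paraboloid {R : realType} {n : nat} (a b : R) (p : 'rV[R]_n * R) : R :=
  a + b * (2^-1 * (\sum_i p.1 0 i ^+ 2) + p.2).

(** * Paraboloids as test functions *)

Section Paraboloid.
Variables (R : realType) (n : nat).
Implicit Types (a b : R) (p : 'rV[R]_n * R).

Lemma coord_fst_continuous (i : 'I_n) :
  continuous (fun p : 'rV[R]_n * R => p.1 0 i).
Proof.
move=> p; apply: (@continuous_comp _ _ _ fst (fun x : 'rV[R]_n => x 0 i)).
  exact: cvg_fst.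
exact: coord_continuous.
Qed.

Lemma paraboloid_continuous a b :
  continuous (paraboloid a b : 'rV[R]_n * R -> R).
Proof.
move=> p; apply: cvgD; first exact: cvg_cst.
apply: cvgM; first exact: cvg_cst.
apply: cvgD; last exact: cvg_snd.
apply: cvgM; first exact: cvg_cst.
apply: cvg_big => [|i _]; first exact: add_continuous.
by apply: (@continuous_comp _ _ _ (fun p : 'rV[R]_n * R => p.1 0 i) (fun x => x ^+ 2));
  [exact: coord_fst_continuous | exact: exprn_continuous].
Qed.

Lemma is_derive_paraboloid_x a b (i : 'I_n) p :
  is_derive p (dir R (Some i)) (paraboloid a b) (b * p.1 0 i).
Proof.
apply: (@is_derive_quadratic _ _ _ _ _ _ (b / 2)) => t.
rewrite /paraboloid /= (bigD1 i) //= [in RHS](bigD1 i) //= !mxE !eqxx /=.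
rewrite [in LHS](eq_bigr (fun j => p.1 0 j ^+ 2)); last first.
  by move=> j /negPf ji; rewrite !mxE ji mulr0 add0r.
by rewrite /GRing.scale /=; field.
Qed.

Lemma is_derive_paraboloid_z a b p :
  is_derive p (dir R None) (paraboloid a b) b.
Proof.
apply: (@is_derive_quadratic _ _ _ _ _ _ 0) => t.
rewrite /paraboloid /= scaler0 add0r /GRing.scale /=; ring.
Qed.

Lemma is_derive_coord b (i : 'I_n) k p :
  is_derive p (dir R k) (fun p => b * p.1 0 i) (b * (k == Some i)%:R).
Proof.
apply: (@is_derive_quadratic _ _ _ _ _ _ 0) => t.
case: k => [j|] /=; rewrite !mxE ?eqxx /=.
  by rewrite [Some j == _]/(j == i) eq_sym; ring.
ring.
Qed.

Lemma pd_paraboloid a b k :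
  pd k (paraboloid a b) =
  if k is Some i then (fun p : 'rV[R]_n * R => b * p.1 0 i) else cst b.
Proof.
by apply/funext => p; case: k => [i|]; rewrite /pd;
  [case: (is_derive_paraboloid_x a b i p) | case: (is_derive_paraboloid_z a b p)].
Qed.

Lemma pd_pd_paraboloid a b k l :
  pd k (pd l (paraboloid a b)) =
  cst (if l is Some i then b * (k == Some i)%:R else 0)
    :> ('rV[R]_n * R -> R).
Proof.
apply/funext => p; rewrite pd_paraboloid /pd; case: l => [i|].
  by case: (is_derive_coord b i k p).
exact: derive_cst.
Qed.

Lemma pd_paraboloid_continuous a b k :
  continuous (pd k (paraboloid a b) : 'rV[R]_n * R -> R).
Proof.
rewrite pd_paraboloid; case: k => [i p|]; last exact: cst_continuous.
by apply: cvgM; [exact: cvg_cst | exact: coord_fst_continuous].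
Qed.

Lemma paraboloid_C2 a b (A : set ('rV[R]_n * R)) : C2 A (paraboloid a b).
Proof.
split=> [p _|k|k l]; first exact: paraboloid_continuous.
- split=> p _; last exact: pd_paraboloid_continuous.
  case: k => [i|]; first by case: (is_derive_paraboloid_x a b i p).
  by case: (is_derive_paraboloid_z a b p).
- split=> p _; last by rewrite pd_pd_paraboloid; exact: cst_continuous.
  rewrite pd_paraboloid; case: l => [i|]; last exact: derivable_cst.
  by case: (is_derive_coord b i k p).
Qed.

(** The paraboloid is affine in z, so the weight, which blows up as z tends to 0 when [s < 1/2],
    only ever multiplies zero. *)
Lemma weighted_dzz_paraboloid s a b :
  weighted_dzz s (paraboloid a b) = cst 0 :> ('rV[R]_n * R -> R).
Proof.
by apply/funext => p; rewrite /weighted_dzz pd_pd_paraboloid /= mulr0.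
Qed.

Lemma lap_x_paraboloid a b p : lap_x (paraboloid a b) p = b * n%:R.
Proof.
rewrite /lap_x (eq_bigr (fun=> b)); first by rewrite sumr_const card_ord mulr_natr.
by move=> i _; rewrite pd_pd_paraboloid eqxx mulr1.
Qed.

Lemma continuous_up_to_closureT (A : set ('rV[R]_n * R)) (f : 'rV[R]_n * R -> R) :
  continuous f -> continuous_up_to_closure A f.
Proof. by move=> cf; exists f => //; exact: continuous_subspaceT. Qed.

Lemma paraboloid_Cs s a b : Cs s (paraboloid a b : 'rV[R]_n * R -> R).
Proof.
split; first exact: paraboloid_C2.
- exact/continuous_subspaceT/paraboloid_continuous.
- by move=> i; exact/continuous_up_to_closureT/pd_paraboloid_continuous.
- move=> i j; apply/continuous_up_to_closureT.
  by rewrite pd_pd_paraboloid; exact: cst_continuous.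
- split; first exact/continuous_up_to_closureT/pd_paraboloid_continuous.
  apply/continuous_up_to_closureT.
  by rewrite weighted_dzz_paraboloid; exact: cst_continuous.
Qed.

Lemma dz_T1_paraboloid s a b (x : 'rV[R]_n) :
  closure (D n s) (x, 0) -> dz_T1 s (paraboloid a b) x = b.
Proof.
move=> Dx; rewrite /dz_T1 /extension pd_paraboloid.
(* Since [(x, 0)] is in the closure of D, the filter is proper, so the limit of the constant [b]
   along it is unique. *)
have FF := within_nbhs_proper Dx.
by apply: cvg_lim => //; exact: cvg_cst.
Qed.

End Paraboloid.

(** * Topology of D and its boundary *)

Section Domain.
Variables (R : realType) (n : nat) (s : R).
Hypotheses (s_gt0 : 0 < s) (s_lt1 : s < 1).

Lemma h_coef_gt0 : 0 < s ^+ 2 / (1 - s).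
Proof. by rewrite divr_gt0 ?exprn_gt0// subr_gt0. Qed.

Lemma h0 : h s 0 = 0.
Proof. by rewrite /h normr0 powR0 ?mulr0// gt_eqF ?invr_gt0. Qed.

Lemma le_h (y z : R) : 0 <= y -> y <= z -> h s y <= h s z.
Proof.
move=> y0 yz; rewrite /h ler_wpM2l ?(ltW h_coef_gt0)//.
rewrite ge0_ler_powR ?nnegrE ?normr_ge0 ?invr_ge0 ?(ltW s_gt0)//.
by rewrite !ger0_norm// (le_trans y0 yz).
Qed.

(** Let c be the coefficient in [h]. Either [z <= 1], or [z <= z^(1/s) < 1/c] because [1/s >= 1];
    the sum covers both cases. *)
Lemma S1p_le (z : R) : S1p s z -> z <= 1 + (s ^+ 2 / (1 - s))^-1.
Proof.
move=> [z0 hz]; have c0 := h_coef_gt0.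
have ci0 : 0 < (s ^+ 2 / (1 - s))^-1 by rewrite invr_gt0.
have [z1|/ltW z1] := lerP z 1; first by rewrite (le_trans z1)// lerDl ltW.
have zh : z <= `|z| `^ s^-1.
  by rewrite gtr0_norm// le1r_powR// invf_ge1// ltW.
rewrite (le_trans zh)// ler_wpDl//.
by rewrite -[leRHS]mul1r ler_pdivlMr// mulrC ltW.
Qed.

Lemma S1_coord_le (x : 'rV[R]_n) i : S1 x -> - 2 <= x 0 i <= 2.
Proof.
rewrite /S1 /= (bigD1 i)//= => xS.
have : 0 <= \sum_(j | j != i) x 0 j ^+ 2 by apply: sumr_ge0 => j _; exact: sqr_ge0.
move=> ?; apply/andP; split; nra.
Qed.

Lemma closure_D_compact : compact (closure (D n s)).
Proof.
pose M : R := 1 + (s ^+ 2 / (1 - s))^-1.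
pose B : set ('rV[R]_n * R) :=
  [set v : 'rV[R]_n | forall i, `[- 2, 2]%classic (v ord0 i)] `*` `[0, M]%classic.
have cB : compact B.
  apply: compact_setX; last exact: segment_compact.
  by apply: (@rV_compact R n (fun=> `[- 2, 2]%classic)) => i; exact: segment_compact.
have clB : closed B by apply: (compact_closed _ cB); exact: norm_hausdorff.
apply: subclosed_compact cB _; first exact: closed_closure.
rewrite [X in _ `<=` X]((closure_id _).1 clB).
apply: closure_subset => -[x z] [/= xS zS]; split => /=.
  by move=> i; rewrite in_itv/= S1_coord_le.
by rewrite in_itv/= S1p_le// ltW//; case: zS.
Qed.

Lemma D_nonempty : D n s !=set0.
Proof.
pose c := s ^+ 2 / (1 - s); have c0 : 0 < c := h_coef_gt0.
(* As [z <= 1] and [1/s >= 1], one has [z^(1/s) <= z <= 1/(c+1) < 1/c], that is [h z < 1]. *)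
pose z : R := Num.min 1 ((c + 1)^-1).
have z0 : 0 < z by rewrite lt_min ltr01 invr_gt0; lra.
have z1 : z <= 1 by rewrite ge_min lexx.
exists (0, z); split => /=.
  rewrite /S1 /= big1 ?mulr0// => i _.
  by rewrite mxE expr0n.
split => //; rewrite /h gtr0_norm// -/c.
have -> : 1 = c * c^-1 by rewrite divff// gt_eqF.
rewrite ltr_pM2l//.
apply: (@le_lt_trans _ _ z).
  by rewrite ge1r_powR ?z0// invf_ge1// ltW.
by rewrite /z gt_min ltf_pV2 ?posrE; lra.
Qed.

Lemma T1_sub_closure_D : T1 n `<=` closure (D n s).
Proof.
move=> [x y] [Sx /= ->] A [[U V] [/= Ux /nbhs_ballP[e /= e0 eV]] UVA].
have [[x1 z1] [_ [/= z10 hz1]]] := D_nonempty.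
(* Lowering the height [z1] keeps it in [S1p] by monotonicity of [h], and [e / 2] brings it within
   [e] of 0. *)
pose z := Num.min z1 (e / 2).
have z0 : 0 < z by rewrite lt_min z10 divr_gt0.
exists (x, z); split.
  split => //; split => //; apply: le_lt_trans hz1; apply: le_h; first exact: ltW.
  by rewrite ge_min lexx.
apply: UVA; split => /=; first exact: nbhs_singleton.
apply: eV; rewrite /ball /= sub0r normrN gtr0_norm//.
by rewrite gt_min; apply/orP; right; lra.
Qed.

Lemma closure_D_snd_ge0 p : closure (D n s) p -> 0 <= p.2.
Proof.
move=> Dp; suff : [set q : 'rV[R]_n * R | 0 <= q.2] p by [].
have c : closed [set q : 'rV[R]_n * R | 0 <= q.2].
  apply: (@preimage_closed _ _ snd [set y : R | 0 <= y]); last exact: closed_ge.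
  by move=> q _; exact: cvg_snd.
apply: c; move: Dp; apply: closure_subset => q [_ [/ltW]] //.
Qed.

(** The delicate points are those of the edge, with [p.2 = 0] and [p.1] outside [S1]. They are
    limits of points [(p.1, z)] with z in [S1p], which lie in the closure of D but not in D; the
    outer closure in [upper_boundary] captures them. *)
Lemma closure_D_split p :
  closure (D n s) p -> [\/ D n s p, T1 n p | upper_boundary n s p].
Proof.
move=> Dp; have [Dp'|nDp] := pselect (D n s p); first exact: Or31.
have upperP (q : 'rV[R]_n * R) : closure (D n s) q -> ~ D n s q -> 0 < q.2 ->
    ((closure (D n s) `\` interior (D n s)) `&` [set p | 0 < p.2]) q.
  by move=> Dq nDq q0; split => //; split => // /interior_subset.
have := closure_D_snd_ge0 _ Dp; rewrite le_eqVlt => /predU1P[p20|p2]; last first.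
  by apply: Or33; apply: subset_closure; exact: upperP.
have [Sp|nSp] := pselect (S1 p.1); first by apply: Or32; split.
apply: Or33 => A pA.
have Dp1 : closure (@S1 R n) p.1.
  move=> U pU; have [|q [[Sq _] Uq]] := Dp (fst @^-1` U); first exact: cvg_fst.
  by exists q.1.
case: (pA) => -[U V] [/= pU pV] UVA.
have [|q [[_ Sq] Vq]] := Dp (snd @^-1` V); first exact: cvg_snd.
exists (p.1, q.2); split; last first.
  by apply: UVA; split => //=; exact: nbhs_singleton.
apply: upperP => /=; [|by case|by case: Sq].
move=> B [[U' V'] [/= qU qV] UVB].
have [x [Sx Ux]] := Dp1 _ qU.
exists (x, q.2); split; first by split.
by apply: UVB; split => //=; exact: nbhs_singleton.
Qed.

Lemma upper_boundary_sub : upper_boundary n s `<=` closure (D n s).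
Proof.
rewrite [X in _ `<=` X]((closure_id _).1 (@closed_closure _ _)).
by apply: closure_subset => p [[]].
Qed.

Lemma upper_boundary_compact : compact (upper_boundary n s).
Proof.
apply: subclosed_compact closure_D_compact upper_boundary_sub.
exact: closed_closure.
Qed.

(** * Convexity and touching sets *)

Lemma S1_convex (x y : 'rV[R]_n) (t : R) : 0 <= t -> t <= 1 ->
  S1 x -> S1 y -> S1 (t *: x + (1 - t) *: y).
Proof.
rewrite /S1 /= => t0 t1 Sx Sy.
have : \sum_i (t *: x + (1 - t) *: y) 0 i ^+ 2 <=
    t * (\sum_i x 0 i ^+ 2) + (1 - t) * (\sum_i y 0 i ^+ 2).
  rewrite !mulr_sumr -big_split/=; apply: ler_sum => i _; rewrite !mxE.
  rewrite -subr_ge0.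
  (* The convexity defect of the square is [t (1 - t) (x_i - y_i)^2]. *)
  have -> : t * x 0 i ^+ 2 + (1 - t) * y 0 i ^+ 2 - (t * x 0 i + (1 - t) * y 0 i) ^+ 2
    = t * (1 - t) * (x 0 i - y 0 i) ^+ 2 by ring.
  by rewrite mulr_ge0 ?sqr_ge0// mulr_ge0// subr_ge0.
move: (\sum_i (t *: x + (1 - t) *: y) 0 i ^+ 2) => Z ZXY.
(* A convex combination is at most the larger of the two sums, hence less than 2. *)
by case: (lerP (\sum_i x 0 i ^+ 2) (\sum_i y 0 i ^+ 2)) => *; nra.
Qed.

(** Shared by both touching sets: each is [S1] times a convex set of heights, with or without 0. *)
Lemma convex_setX_S1 (J : set R) :
  (forall (y z t : R), 0 <= t -> t <= 1 -> J y -> J z -> J (t * y + (1 - t) * z)) ->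
  convex_set ((@S1 R n `*` J) : set (convex_lmodType _)).
Proof.
move=> cJ p q t; rewrite !inE => -[Sp Jp] [Sq Jq].
have t0 : 0 <= t%:num by [].
have t1 : t%:num <= 1 by [].
split; first exact: S1_convex.
exact: cJ.
Qed.

(** Monotonicity of [h] is enough, since the combination is at most the larger of [y] and [z]. *)
Lemma h_convex_lt1 (y z t : R) : 0 <= t -> t <= 1 -> 0 <= y -> 0 <= z ->
  h s y < 1 -> h s z < 1 -> h s (t * y + (1 - t) * z) < 1.
Proof.
move=> t0 t1 y0 z0 hy hz; have [yz|/ltW zy] := lerP y z.
  by apply: le_lt_trans hz; apply: le_h; nra.
by apply: le_lt_trans hy; apply: le_h; nra.
Qed.

(** Openness is relative to the ambient set, so the whole of D qualifies; this fits contact at a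
    global maximum. *)
Lemma D_touching p : D n s p -> touching_set (D n s) p (D n s).
Proof.
move=> Dp; split => //; first exact: open_subspaceT.
apply: convex_setX_S1 => y z t t0 t1 [y0 hy] [z0 hz]; split; first by nra.
by apply: h_convex_lt1 => //; exact: ltW.
Qed.

Lemma DT1_touching p :
  T1 n p -> touching_set (D n s `|` T1 n) p (D n s `|` T1 n).
Proof.
move=> Tp; split => //; [by right|exact: open_subspaceT|].
(* Height 0 satisfies [h s 0 = 0 < 1], so the union is again a product. *)
have -> : D n s `|` T1 n = @S1 R n `*` [set z | 0 <= z /\ h s z < 1].
  apply/seteqP; split=> [q [[Sq [q0 hq]]|[Sq q0]]|[x z] [Sx [z0 hz]]].
  - by split => //; split => //; exact: ltW.
  - by split => //=; rewrite q0 h0 lexx ltr01.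
  - move: z0; rewrite le_eqVlt => /predU1P[z0|z0]; last by left.
    by right; split.
apply: convex_setX_S1 => y z t t0 t1 [y0 hy] [z0 hz]; split; first by nra.
exact: h_convex_lt1.
Qed.

End Domain.

(** * Maximum principle from the absence of touching paraboloids *)

Section MaximumPrinciple.
Variables (R : realType) (n : nat) (s : R) (F : 'rV[R]_n * R -> R).
Hypotheses (s_gt0 : 0 < s) (s_lt1 : s < 1).
Hypothesis F_cont : {within closure (D n s), continuous F}.
(** Stated for an abstract [F], so that the section applies both to [H] and to [- H]. *)
Hypothesis no_touch_D : forall a e p, 0 < e -> D n s p ->
  ~ touches_above (D n s) (paraboloid a (- e)) F p.
Hypothesis no_touch_T1 : forall a e x, 0 < e -> T1 n (x, 0) ->
  ~ touches_above (D n s `|` T1 n) (paraboloid a (- e)) F (x, 0).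

Let P : 'rV[R]_n * R -> R := paraboloid 0 1.

Lemma paraboloidE a b (p : 'rV[R]_n * R) : paraboloid a b p = a + b * P p.
Proof. by rewrite /P /paraboloid; ring. Qed.

Lemma closure_D_nonempty : closure (D n s) !=set0.
Proof. by have [p Dp] := D_nonempty R n s s_gt0 s_lt1; exists p; exact: subset_closure. Qed.

Lemma perturbed_max_upper_boundary e : 0 < e ->
  exists2 p, upper_boundary n s p &
    forall q, closure (D n s) q -> F q + e * P q <= F p + e * P p.
Proof.
move=> e0.
have cG : {within closure (D n s), continuous (fun q => F q + e * P q)}.
  move=> q; apply: cvgD; first exact: F_cont.
  apply: cvgM; first exact: cvg_cst.
  exact: continuous_subspaceT (paraboloid_continuous _ _ _ _) q.
have [p] := compact_EVT_max closure_D_nonempty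
  (closure_D_compact _ _ _ s_gt0 s_lt1) cG.
rewrite inE => Dp pmax; exists p; last by move=> q Dq; apply: pmax; rewrite inE.
(* With [a] the maximum of [F + e * P], the function [a - e * P] lies above [F] on the whole closure
   and meets it at [p]. *)
have above (q : 'rV[R]_n * R) : closure (D n s) q ->
    F q <= paraboloid (F p + e * P p) (- e) q.
  by move=> Dq; rewrite paraboloidE; have := pmax q (mem_set Dq); lra.
have Fp : paraboloid (F p + e * P p) (- e) p = F p by rewrite paraboloidE; ring.
have [Dp'|Tp|//] := closure_D_split _ _ _ _ Dp.
- exfalso; apply: (no_touch_D (F p + e * P p) e p) => //.
  exists (D n s); first exact: D_touching.
  by split => // q Dq; apply/above/subset_closure.
- case: p Tp Fp pmax above {Dp} => x z [Sx /= ->] Fp _ above.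
  exfalso; apply: (no_touch_T1 (F (x, 0) + e * P (x, 0)) e x) => //.
  exists (D n s `|` T1 n); first exact: DT1_touching.
  split => // q [Dq|Tq]; apply: above; first exact: subset_closure.
  exact: (T1_sub_closure_D _ _ _ s_gt0 s_lt1).
Qed.

Lemma max_upper_boundary :
  exists2 p, upper_boundary n s p & forall q, closure (D n s) q -> F q <= F p.
Proof.
(* The value 1 is arbitrary: this yields a point of [upper_boundary], so that the extreme value
   theorem applies there. *)
have [p1 Up1 _] := perturbed_max_upper_boundary 1 ltr01.
have [|p0] := compact_EVT_max _ (upper_boundary_compact R n s s_gt0 s_lt1)
  (continuous_subspaceW (upper_boundary_sub R n s) F_cont).
  by exists p1.
rewrite inE => Up0 p0max; exists p0 => // q Dq.
have [pB] := compact_EVT_max closure_D_nonempty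
  (closure_D_compact R n s s_gt0 s_lt1)
  (continuous_subspaceT (paraboloid_continuous R n 0 1)).
rewrite inE -/P => DpB Pmax.
have P_ge0 (r : 'rV[R]_n * R) : closure (D n s) r -> 0 <= P r.
  move=> /closure_D_snd_ge0 r0.
  have : 0 <= \sum_i r.1 0 i ^+ 2 by apply: sumr_ge0 => i _; exact: sqr_ge0.
  rewrite /P /paraboloid; lra.
have B0 := P_ge0 _ DpB.
rewrite leNgt; apply/negP => lt_p0q.
(* One small [e] replaces the limit. It makes [e * P pB] less than the gap [F q - F p0], while
   [F q <= F p + e * P p <= F p0 + e * P pB]; the [+ 1] keeps the denominator positive. *)
pose e := (F q - F p0) / (2 * (P pB + 1)).
have e0 : 0 < e by rewrite divr_gt0; lra.
have [p Up pmax] := perturbed_max_upper_boundary e e0.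
have Fp := p0max p (mem_set Up).
have Pp := Pmax p (mem_set (upper_boundary_sub R n s p Up)).
have Fq := pmax q Dq.
have ePq : 0 <= e * P q by rewrite mulr_ge0 ?(ltW e0)//; exact: P_ge0.
have ePp : e * P p <= e * P pB by rewrite ler_wpM2l// ltW.
have eE : e * (2 * (P pB + 1)) = F q - F p0 by rewrite divfK//; lra.
lra.
Qed.

End MaximumPrinciple.

Theorem lemma5p4 (R : realType) (n : nat) (s : R) (H : 'rV[R]_n * R -> R)
    (hn : (1 <= n)%N) (hs0 : 0 < s) (hs1 : s < 1)
    (H_cont : {within closure (D n s), continuous H})
    (H_sol : Cs_solution s H) :
  (exists2 p, upper_boundary n s p & forall q, closure (D n s) q -> H q <= H p) /\
  (exists2 p, upper_boundary n s p & forall q, closure (D n s) q -> H p <= H q).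
Proof.
have [[_ subD subT] [_ supD supT]] := H_sol.
(* This makes the Laplacian [- e * n] of the test function strictly negative. *)
have n0 : 0 < n%:R :> R by rewrite ltr0n.
split.
  apply: max_upper_boundary => // [a e p e0 Dp|a e x e0 Tx] tch.
    have := subD _ _ Dp (paraboloid_C2 _ _ _ _ _) tch.
    rewrite lap_x_paraboloid weighted_dzz_paraboloid /=; nra.
  have := subT _ _ Tx (paraboloid_Cs _ _ _ _ _) tch.
  rewrite dz_T1_paraboloid; [lra | exact: T1_sub_closure_D].
(* Contact from above with [- H] is contact from below with [H], so the supersolution conditions
   rule it out. *)
have touchN A a e p : touches_above A (paraboloid a (- e)) (fun q => - H q) p ->
    touches_below A (paraboloid (- a) e) H p.
  have NE q : paraboloid (- a) e q = - paraboloid a (- e) q :> R.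
    by rewrite /paraboloid; ring.
  case=> E tE [pE aE]; exists E => //; split=> [|q Eq].
    by rewrite NE pE opprK.
  by rewrite NE lerNl aE.
have cN : {within closure (D n s), continuous (fun q => - H q)}.
  by move=> q; apply: cvgN; exact: H_cont.
have [|||p Up pmax] := max_upper_boundary R n s (fun q => - H q) hs0 hs1.
- exact: cN.
- move=> a e p e0 Dp /touchN tch.
  have := supD _ _ Dp (paraboloid_C2 _ _ _ _ _) tch.
  rewrite lap_x_paraboloid weighted_dzz_paraboloid /=; nra.
- move=> a e x e0 Tx /touchN tch.
  have := supT _ _ Tx (paraboloid_Cs _ _ _ _ _) tch.
  rewrite dz_T1_paraboloid; [lra | exact: T1_sub_closure_D].
by exists p => // q Dq; have := pmax q Dq; rewrite lerN2.
Qed.
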